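(* Let $\widetilde{H},\widetilde{K}$ be groups with normal subgroups $M\trianglelefteq\widetilde{H}$, $N\trianglelefteq\widetilde{K}$, and let $H=\widetilde{H}/M$, $K=\widetilde{K}/N$, identified with transversals containing $e$. Let $f:H\to K$ and $\alpha:M\to N$ be bijections fixing $e$, let $\gamma:M\to N$ be a bijection, let $f^{*}:\widetilde{H}\to\widetilde{K}$ be the bijection extending $f$ and $\alpha$ (by means of $\gamma$) described in the context, let $\widetilde{G}=G(\widetilde{H},\widetilde{K};f^{*})$, and let $V$ be the normal closure of $\langle M,N\rangle$ in $\widetilde{G}$. Suppose that $M,N$ are central subgroups of $\widetilde{H},\widetilde{K}$ respectively and that $G(M,N;\alpha)$ is abelian. Then $V$ is an abelian group. If furthermore $H,K$ are abelian, then $[V,\widetilde{G}]^{2}$ is central in $\widetilde{G}$.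
   Context: Maps are written on the right or as exponents. For groups $X,Y$ and a bijection $\phi:X\to Y$ fixing the identity ($e^{\phi}=e$), $G(X,Y;\phi)=\langle X,Y\mid xx^{\phi}=x^{\phi}x \text{ for all } x\in X\rangle$, i.e. the quotient of the free product $X*Y$ by the normal closure of all commutators $[x,x^{\phi}]$, $x\in X$. Extension of bijections: choose a transversal of $M$ in $\widetilde{H}$ containing $e$ and identify it with $H=\widetilde{H}/M$; likewise choose a transversal of $N$ in $\widetilde{K}$ containing $e$ and identify it with $K=\widetilde{K}/N$. Given bijections $f:H\to K$, $\alpha:M\to N$ fixing $e$, and a bijection $\gamma:M\to N$ (not necessarily fixing $e$), define $f^{*}:\widetilde{H}\to\widetilde{K}$ by $m^{f^{*}}=m^{\alpha}$ for $m\in M$, and $(mh)^{f^{*}}=m^{\gamma}h^{f}$ for $m\in M$, $e\neq h\in H$ (with $H$, $K$ regarded as the transversals). This is a bijection fixing $e$. For the abelian subgroup $[V,\widetilde{G}]$ (generated by the commutators $[v,g]$, $v\in V,g\in\widetilde G$), $[V,\widetilde{G}]^{2}$ denotes its subgroup of squares. *)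

(* Defs.v *)
From HB Require Import structures.
From mathcomp Require Import all_boot.
From mathcomp Require Import boolp classical_sets.

Set Implicit Arguments.
Unset Strict Implicit.
Unset Printing Implicit Defensive.

Local Open Scope group_scope.
Local Open Scope quotient_scope.

(* Groups are [groupType]s, hence possibly infinite.  A subgroup of [G] is a
   [groupClosed G], i.e. a boolean predicate closed under the group operations;
   with the classical axioms of [boolp] every subset is of this form. *)

HB.mixin Record isConjClosed (G : groupType) (N : {pred G}) := {
  gpredJr : forall x g : G, x \in N -> x ^ g \in N
}.

#[short(type="normalClosed")]
HB.structure Definition NormalClosed (G : groupType) :=
  {N of isConjClosed G N & GroupClosed G N}.

Section Subgroup.
Variables (G : groupType) (M : groupClosed G).

Definition subgroup : Type := {x : G | x \in M}.

HB.instance Definition _ := SubType.copy subgroup {x : G | x \in M}.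
HB.instance Definition _ := [Choice of subgroup by <:].

Fact subgroup_closed : group_closed (fun x : G => x \in M).
Proof. by split=> [|x y]; [exact: gpred1 | exact: gpredF]. Qed.

HB.instance Definition _ :=
  SubChoice_isSubGroup.Build G (fun x : G => x \in M) subgroup subgroup_closed.
End Subgroup.

Section Quotient.
Variables (G : groupType) (N : normalClosed G).

Definition quot_rel : rel G := fun x y => x / y \in N.

Fact quot_rel_refl : reflexive quot_rel.
Proof. by move=> x; rewrite /quot_rel mulgV gpred1. Qed.

Fact quot_rel_sym : symmetric quot_rel.
Proof. by move=> x y; rewrite /quot_rel gpredFC. Qed.

Fact quot_rel_trans : transitive quot_rel.
Proof.
move=> y x z xy yz.
by rewrite /quot_rel -(mulgVK y x) -mulgA gpredM.
Qed.

Canonical quot_equiv_rel :=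
  EquivRel quot_rel quot_rel_refl quot_rel_sym quot_rel_trans.

Definition quotient : Type := {eq_quot quot_equiv_rel}.

HB.instance Definition _ := Choice.copy quotient {eq_quot quot_equiv_rel}.
HB.instance Definition _ := EqQuotient.copy quotient {eq_quot quot_equiv_rel}.

Definition quot_proj (x : G) : quotient := \pi_quotient x.

Lemma quot_projP x y : quot_proj x = quot_proj y <-> x / y \in N.
Proof. by split=> [/eqmodP | ?]; last exact/eqmodP. Qed.

Lemma quot_reprK : cancel (repr : quotient -> G) quot_proj.
Proof. exact: reprK. Qed.

Definition quot_mul (a b : quotient) : quotient := quot_proj (repr a * repr b).
Definition quot_inv (a : quotient) : quotient := quot_proj (repr a)^-1.

Lemma quot_mulE x y : quot_mul (quot_proj x) (quot_proj y) = quot_proj (x * y).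
Proof.
have xr : repr (quot_proj x) / x \in N by apply/quot_projP/quot_reprK.
have yr : repr (quot_proj y) / y \in N by apply/quot_projP/quot_reprK.
apply/quot_projP; move: (gpredM _ _ xr (gpredJr _ x^-1 yr)).
by rewrite /conjg invgM invgK !mulgA mulgVK.
Qed.

Lemma quot_invE x : quot_inv (quot_proj x) = quot_proj x^-1.
Proof.
have : x / repr (quot_proj x) \in N.
  by rewrite gpredFC; apply/quot_projP/quot_reprK.
move/(gpredJr _ x) => xr; apply/quot_projP; move: xr.
by rewrite /conjg invgK !mulgA mulVg mul1g.
Qed.

Fact quot_mulA : associative quot_mul.
Proof.
move=> a b c; rewrite -(quot_reprK a) -(quot_reprK b) -(quot_reprK c).
by rewrite !quot_mulE mulgA.
Qed.

Fact quot_mul1 : left_id (quot_proj 1) quot_mul.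
Proof. by move=> a; rewrite -(quot_reprK a) quot_mulE mul1g. Qed.

Fact quot_mulr1 : right_id (quot_proj 1) quot_mul.
Proof. by move=> a; rewrite -(quot_reprK a) quot_mulE mulg1. Qed.

Fact quot_mulV : left_inverse (quot_proj 1) quot_inv quot_mul.
Proof. by move=> a; rewrite -(quot_reprK a) quot_invE quot_mulE mulVg. Qed.

Fact quot_mulrV : right_inverse (quot_proj 1) quot_inv quot_mul.
Proof. by move=> a; rewrite -(quot_reprK a) quot_invE quot_mulE mulgV. Qed.

HB.instance Definition _ :=
  isGroup.Build quotient quot_mulA quot_mul1 quot_mulr1 quot_mulV quot_mulrV.

Fact quot_projF : {morph quot_proj : x y / x / y}.
Proof. by move=> x y; rewrite -quot_mulE -quot_invE. Qed.

HB.instance Definition _ := isGroupMorphism.Build G quotient quot_proj quot_projF.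
End Quotient.

Section Generation.
Variables (G : groupType) (S : set G).

Definition gen : {pred G} :=
  fun x => `[< forall K : groupClosed G, (forall s, S s -> s \in K) -> x \in K >].

Fact gen_mul : mulg_closed gen.
Proof.
move=> x y /asboolP xS /asboolP yS; apply/asboolP => K SK.
by rewrite gpredM ?xS ?yS.
Qed.
Fact gen_1 : 1 \in gen.
Proof. by apply/asboolP => K _; apply: gpred1. Qed.
Fact gen_inv : invg_closed gen.
Proof. by move=> x /asboolP xS; apply/asboolP => K SK; rewrite gpredV xS. Qed.

HB.instance Definition _ := isMulClosed.Build G gen gen_mul.
HB.instance Definition _ := isMul1Closed.Build G gen gen_1.
HB.instance Definition _ := isInvClosed.Build G gen gen_inv.

Definition nclosure : {pred G} :=
  fun x => `[< forall K : normalClosed G, (forall s, S s -> s \in K) -> x \in K >].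

Fact nclosure_mul : mulg_closed nclosure.
Proof.
move=> x y /asboolP xS /asboolP yS; apply/asboolP => K SK.
by rewrite gpredM ?xS ?yS.
Qed.
Fact nclosure_1 : 1 \in nclosure.
Proof. by apply/asboolP => K _; apply: gpred1. Qed.
Fact nclosure_inv : invg_closed nclosure.
Proof. by move=> x /asboolP xS; apply/asboolP => K SK; rewrite gpredV xS. Qed.
Fact nclosure_conj x g : x \in nclosure -> x ^ g \in nclosure.
Proof. by move=> /asboolP xS; apply/asboolP => K SK; rewrite gpredJr ?xS. Qed.

HB.instance Definition _ := isMulClosed.Build G nclosure nclosure_mul.
HB.instance Definition _ := isMul1Closed.Build G nclosure nclosure_1.
HB.instance Definition _ := isInvClosed.Build G nclosure nclosure_inv.
HB.instance Definition _ := isConjClosed.Build G nclosure nclosure_conj.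
End Generation.

Definition central (G : groupType) (A : set G) : Prop :=
  forall a, A a -> forall g : G, commute a g.

Definition commutative_on (G : groupType) (A : {pred G}) : Prop :=
  {in A &, forall x y, commute x y}.

Definition abelian_group (G : groupType) : Prop := forall x y : G, commute x y.

Definition commutator_subgroup (G : groupType) (A : {pred G}) : {pred G} :=
  gen [set [~ v, g] | v in [set` A] & g in [set: G]]%classic.

Definition squares (G : groupType) (A : {pred G}) : set G :=
  [set u ^+ 2 | u in [set` A]]%classic.

Section FreeProduct.
Variables X Y : groupType.

(* The free product is the monoid of words in the disjoint union of X and Y
   modulo the congruence generated by the multiplication tables of X and Y. *)
Inductive fp_eq : seq (X + Y) -> seq (X + Y) -> Prop :=
| fp_refl u : fp_eq u u
| fp_sym u v : fp_eq u v -> fp_eq v u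
| fp_trans u v w : fp_eq u v -> fp_eq v w -> fp_eq u w
| fp_cat u u' v v' : fp_eq u u' -> fp_eq v v' -> fp_eq (u ++ v) (u' ++ v')
| fp_l1 : fp_eq [:: inl 1] [::]
| fp_r1 : fp_eq [:: inr 1] [::]
| fp_lM x x' : fp_eq [:: inl x; inl x'] [:: inl (x * x')]
| fp_rM y y' : fp_eq [:: inr y; inr y'] [:: inr (y * y')].

Definition fp_rel : rel (seq (X + Y)) := fun u v => `[< fp_eq u v >].

Fact fp_rel_refl : reflexive fp_rel.
Proof. by move=> u; apply/asboolP; constructor. Qed.
Fact fp_rel_sym : symmetric fp_rel.
Proof. by move=> u v; apply/asboolP/asboolP; exact: fp_sym. Qed.
Fact fp_rel_trans : transitive fp_rel.
Proof. by move=> v u w /asboolP uv /asboolP /(fp_trans uv) ?; apply/asboolP. Qed.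

Canonical fp_equiv_rel := EquivRel fp_rel fp_rel_refl fp_rel_sym fp_rel_trans.

Definition freeprod : Type := {eq_quot fp_equiv_rel}.

HB.instance Definition _ := Choice.copy freeprod {eq_quot fp_equiv_rel}.
HB.instance Definition _ := EqQuotient.copy freeprod {eq_quot fp_equiv_rel}.

Definition fp_class (u : seq (X + Y)) : freeprod := \pi_freeprod u.

Lemma fp_classP u v : fp_class u = fp_class v <-> fp_eq u v.
Proof. by split=> [/eqmodP/asboolP | ?] //; apply/eqmodP/asboolP. Qed.

Lemma fp_reprK : cancel (repr : freeprod -> seq (X + Y)) fp_class.
Proof. exact: reprK. Qed.

Definition letter_inv (a : X + Y) : X + Y :=
  match a with inl x => inl x^-1 | inr y => inr y^-1 end.
Definition word_inv (u : seq (X + Y)) := rev (map letter_inv u).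

Definition fp_mul (a b : freeprod) : freeprod := fp_class (repr a ++ repr b).
Definition fp_inv (a : freeprod) : freeprod := fp_class (word_inv (repr a)).

Lemma fp_mulE u v : fp_mul (fp_class u) (fp_class v) = fp_class (u ++ v).
Proof. by apply/fp_classP/fp_cat; apply/fp_classP/fp_reprK. Qed.

Lemma word_inv_eq u v : fp_eq u v -> fp_eq (word_inv u) (word_inv v).
Proof.
elim=> {u v}.
- by move=> u; apply: fp_refl.
- by move=> u v _; apply: fp_sym.
- by move=> u v w _ uv _; apply: fp_trans.
- move=> u u' v v' _ uu' _ vv'.
  by rewrite /word_inv !map_cat !rev_cat; apply: fp_cat.
- by rewrite /word_inv /rev /= invg1; apply: fp_l1.
- by rewrite /word_inv /rev /= invg1; apply: fp_r1.
- by move=> x x'; rewrite /word_inv /rev /= invgM; apply: fp_lM.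
- by move=> y y'; rewrite /word_inv /rev /= invgM; apply: fp_rM.
Qed.

Lemma fp_invE u : fp_inv (fp_class u) = fp_class (word_inv u).
Proof. by apply/fp_classP/word_inv_eq/fp_classP/fp_reprK. Qed.

Lemma letter_invK : involutive letter_inv.
Proof. by case=> a /=; rewrite invgK. Qed.

Lemma word_invK : involutive word_inv.
Proof.
by move=> u; rewrite /word_inv map_rev revK -map_comp map_id_in // => a _ /=;
  rewrite letter_invK.
Qed.

Lemma word_invV u : fp_eq (u ++ word_inv u) [::].
Proof.
have letterV a : fp_eq [:: a; letter_inv a] [::].
  case: a => z /=.
    by apply: fp_trans (fp_lM _ _) _; rewrite mulgV; apply: fp_l1.
  by apply: fp_trans (fp_rM _ _) _; rewrite mulgV; apply: fp_r1.
elim: u => [|a u IHu]; first exact: fp_refl.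
rewrite /word_inv /= rev_cons -cats1 catA -/(word_inv u) -cat1s.
apply: fp_trans (letterV a).
by apply: (fp_cat (fp_refl [:: a])); apply: (fp_cat IHu (fp_refl _)).
Qed.

Fact fp_mulA : associative fp_mul.
Proof.
move=> a b c; rewrite -(fp_reprK a) -(fp_reprK b) -(fp_reprK c).
by rewrite !fp_mulE catA.
Qed.
Fact fp_mul1 : left_id (fp_class [::]) fp_mul.
Proof. by move=> a; rewrite -(fp_reprK a) fp_mulE. Qed.
Fact fp_mulr1 : right_id (fp_class [::]) fp_mul.
Proof. by move=> a; rewrite -(fp_reprK a) fp_mulE cats0. Qed.
Fact fp_mulrV : right_inverse (fp_class [::]) fp_inv fp_mul.
Proof.
move=> a; rewrite -(fp_reprK a) fp_invE fp_mulE.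
exact/fp_classP/word_invV.
Qed.
Fact fp_mulV : left_inverse (fp_class [::]) fp_inv fp_mul.
Proof.
move=> a; rewrite -(fp_reprK a) fp_invE fp_mulE; apply/fp_classP.
by rewrite -[X in _ ++ X]word_invK; apply: word_invV.
Qed.

HB.instance Definition _ :=
  isGroup.Build freeprod fp_mulA fp_mul1 fp_mulr1 fp_mulV fp_mulrV.

Definition fp_inl (x : X) : freeprod := fp_class [:: inl x].
Definition fp_inr (y : Y) : freeprod := fp_class [:: inr y].

Fact fp_inlF : {morph fp_inl : x y / x / y}.
Proof.
move=> x y; rewrite -[RHS]/(fp_mul _ (fp_inv _)) fp_invE fp_mulE.
by apply/fp_classP/fp_sym/fp_lM.
Qed.
Fact fp_inrF : {morph fp_inr : x y / x / y}.
Proof.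
move=> x y; rewrite -[RHS]/(fp_mul _ (fp_inv _)) fp_invE fp_mulE.
by apply/fp_classP/fp_sym/fp_rM.
Qed.

HB.instance Definition _ := isGroupMorphism.Build X freeprod fp_inl fp_inlF.
HB.instance Definition _ := isGroupMorphism.Build Y freeprod fp_inr fp_inrF.
End FreeProduct.

(* G(X, Y; phi) = < X, Y | x phi(x) = phi(x) x for all x in X >.  The definition
   makes sense for any function phi; bijectivity and phi(1) = 1 are hypotheses
   of its users. *)
Section WeakCommutativity.
Variables (X Y : groupType) (phi : X -> Y).

Definition wc_relators : set (freeprod X Y) :=
  [set [~ fp_inl Y x, fp_inr X (phi x)] | x in [set: X]]%classic.

Definition wc_group : Type := quotient (nclosure wc_relators).

HB.instance Definition _ := Group.copy wc_group (quotient (nclosure wc_relators)).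

Definition wc_inl (x : X) : wc_group := quot_proj (nclosure wc_relators) (fp_inl Y x).
Definition wc_inr (y : Y) : wc_group := quot_proj (nclosure wc_relators) (fp_inr X y).

Fact wc_inlF : {morph wc_inl : x y / x / y}.
Proof. by move=> x y; rewrite /wc_inl fp_inlF quot_projF. Qed.
Fact wc_inrF : {morph wc_inr : x y / x / y}.
Proof. by move=> x y; rewrite /wc_inr fp_inrF quot_projF. Qed.

HB.instance Definition _ := isGroupMorphism.Build X wc_group wc_inl wc_inlF.
HB.instance Definition _ := isGroupMorphism.Build Y wc_group wc_inr wc_inrF.
End WeakCommutativity.

(* A transversal of M containing 1, as the section of the projection that
   identifies the quotient with it. *)
Record based_transversal (G : groupType) (M : normalClosed G) := BasedTransversal {
  trep :> quotient M -> G;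
  trepK : cancel trep (quot_proj M);
  trep1 : trep 1 = 1
}.

Section TransversalTheory.
Variables (G : groupType) (M : normalClosed G) (t : based_transversal M).

Fact mpart_subproof (x : G) : x / t (quot_proj M x) \in M.
Proof. by apply/quot_projP; rewrite trepK. Qed.

(* The factor m of the decomposition x = m h, with m in M, h in t. *)
Definition mpart (x : G) : subgroup M :=
  Sub (x / t (quot_proj M x)) (mpart_subproof x).

Lemma mpartK x : val (mpart x) * t (quot_proj M x) = x.
Proof. by rewrite SubK mulgVK. Qed.

Lemma quot_proj_mul (m : subgroup M) (h : quotient M) :
  quot_proj M (val m * t h) = h.
Proof.
by rewrite -[RHS](trepK t); apply/quot_projP; rewrite mulgK; apply: valP.
Qed.

Lemma mpart_mul (m : subgroup M) (h : quotient M) : mpart (val m * t h) = m.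
Proof. by apply: val_inj; rewrite SubK quot_proj_mul mulgK. Qed.
End TransversalTheory.

Section ExtendedBijection.
Variables (Ht Kt : groupType) (M : normalClosed Ht) (N : normalClosed Kt).
Variables (tH : based_transversal M) (tK : based_transversal N).
Variables (f : quotient M -> quotient N) (alpha gamma : subgroup M -> subgroup N).

Definition fstar (x : Ht) : Kt :=
  let h := quot_proj M x in let m := mpart tH x in
  if h == 1 then val (alpha m) else val (gamma m) * tK (f h).

Lemma fstarM (m : subgroup M) : fstar (val m) = val (alpha m).
Proof.
have := mpart_mul tH m 1; have := quot_proj_mul tH m 1.
by rewrite /fstar trep1 mulg1 => -> ->; rewrite eqxx.
Qed.

Lemma fstarMh (m : subgroup M) (h : quotient M) :
  h <> 1 -> fstar (val m * tH h) = val (gamma m) * tK (f h).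
Proof. by move=> /eqP/negPf h1; rewrite /fstar quot_proj_mul mpart_mul h1. Qed.
End ExtendedBijection.

(* Main.v *)
Require Import Defs.
From HB Require Import structures.
From mathcomp Require Import all_boot.
From mathcomp Require Import boolp classical_sets.

(** Write a, b for the images of x, phi(x) in G(Ht, Kt; phi), with phi = f^*.
    Only three features of phi are needed: x commutes with phi(x), phi is onto,
    and phi induces a bijection from the cosets of M to those of N.  Together
    with the centrality of M and N on their sides and the fact that M commutes
    with N, which follows from G(M, N; alpha) being abelian, they make up the
    predicate [linked], which is symmetric in the two sides.
    For m in M there is n in N with phi(m x) = n phi(x), so m a commutes with
    n b; as M and N are central on their sides and commute with each other,
    this amounts to (lemma [commute_twist])
<<
      m^b n = m n^a,   that is   [m, b] = [n, a] inside an abelian subgroup.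
>>
    Since m^b and m commute with N, so does n^a.  Hence the subgroup B generated
    by M and by the conjugates of N under Ht is abelian ([hull_commutative]).
    The same identity puts the conjugates of M under Kt into B, so B coincides
    with its mirror image ([hullC]), is normalised by Ht and by Kt, and contains
    the normal closure V ([nclosure_hull]).

    Let now the quotients H, K be abelian.  On the abelian group B, Ht acts
    through H.  For n in N put c = [n, a]; it equals [m, b], and since m and b
    commute with a, the element a fixes c ([linked_commg_fix]).  Additively
    n (h - 1)^2 = 0 for all h in H; applying this to a product h h' yields
    2 n (h - 1)(h' - 1) = 0, so that [n, a]^2 is centralised by Ht
    ([linked_commg_sqr_comm]).  Because [n, a] = [m, b], the mirror statement
    shows that it is centralised by Kt too.  The rest is bookkeeping: B is
    abelian, so squares of products split, and commutators [v, g] with v in B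
    reduce to those with v, g generators. *)

Set Implicit Arguments.
Unset Strict Implicit.
Unset Printing Implicit Defensive.

Local Open Scope group_scope.
Local Open Scope classical_set_scope.

(** * Induction on generated subgroups and normal closures *)

Section Induction.
Variables (G : groupType) (S : set G) (P : G -> Prop).
Hypothesis P1 : P 1.
Hypothesis PM : forall x y, P x -> P y -> P (x * y).
Hypothesis PV : forall x, P x -> P x^-1.
Hypothesis PS : forall x, S x -> P x.

Let K : {pred G} := fun x => `[< P x >].

Let KM : mulg_closed K.
Proof. by move=> x y /asboolP Px /asboolP Py; apply/asboolP/PM. Qed.
Let K1 : 1 \in K. Proof. exact/asboolP. Qed.
Let KV : invg_closed K.
Proof. by move=> x /asboolP Px; apply/asboolP/PV. Qed.

Lemma gen_ind x : x \in gen S -> P x.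
Proof.
pose KC : groupClosed G := HB.pack K
  (isMulClosed.Build G K KM) (isMul1Closed.Build G K K1)
  (isInvClosed.Build G K KV).
by move=> /asboolP/(_ KC) xK; apply/asboolP/xK => s /PS Ps; apply/asboolP.
Qed.

Lemma nclosure_ind x :
  (forall x g, P x -> P (x ^ g)) -> x \in nclosure S -> P x.
Proof.
move=> PJ; have KJ y g : y \in K -> y ^ g \in K.
  by move=> /asboolP Py; apply/asboolP/PJ.
pose KC : normalClosed G := HB.pack K
  (isMulClosed.Build G K KM) (isMul1Closed.Build G K K1)
  (isInvClosed.Build G K KV) (isConjClosed.Build G K KJ).
by move=> /asboolP/(_ KC) xK; apply/asboolP/xK => s /PS Ps; apply/asboolP.
Qed.
End Induction.

Lemma mem_gen (G : groupType) (S : set G) x : S x -> x \in gen S.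
Proof. by move=> Sx; apply/asboolP => K; apply. Qed.

Lemma commuteJ (G : groupType) (x y g : G) :
  commute x y -> commute (x ^ g) (y ^ g).
Proof. by rewrite /commute -!conjMg => ->. Qed.

Lemma conjg_commute (G : groupType) (x y : G) : commute x y -> x ^ y = x.
Proof. by move/commgP/conjg_fixP. Qed.

Lemma gen_commutative (G : groupType) (S : set G) :
  (forall x y, S x -> S y -> commute x y) -> commutative_on (gen S).
Proof.
move=> cS; have cSg x y : S x -> y \in gen S -> commute x y.
  move=> Sx; apply: gen_ind => [|a b|a|a]; [exact: commute1|exact: commuteM
    |exact: commuteV|exact: cS].
move=> x y xS yS; move: x xS; apply: gen_ind => [|a b ca cb|a ca|a Sa].
- exact/commute_sym/commute1.
- by apply/commute_sym/commuteM; apply/commute_sym.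
- exact/commute_sym/commuteV/commute_sym.
- exact: cSg.
Qed.

(** * The presentation of G(X, Y; phi) *)

Section Universal.
Variables (X Y G : groupType) (i : UMagmaMorphism.type X G).
Variable j : UMagmaMorphism.type Y G.

(** The value in G of a letter, and of a word, of the free product. *)
Definition letter_eval (a : X + Y) : G :=
  match a with inl x => i x | inr y => j y end.

Definition word_eval (u : seq (X + Y)) : G := \prod_(a <- u) letter_eval a.

Lemma fp_eq_word_eval u v : fp_eq u v -> word_eval u = word_eval v.
Proof.
rewrite /word_eval.
elim=> {u v} //.
- by move=> u v w _ -> _ ->.
- by move=> u u' v v' _ IHu _ IHv; rewrite !big_cat /= IHu IHv.
- by rewrite big_seq1 big_nil /= gmulf1.
- by rewrite big_seq1 big_nil /= gmulf1.
- by move=> x x'; rewrite big_cons !big_seq1 /= gmulfM.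
- by move=> x x'; rewrite big_cons !big_seq1 /= gmulfM.
Qed.

(** The morphism from the free product induced by i and j, computed on the
    chosen representative word; [fp_lift_class] gives it on any word. *)
Definition fp_lift (a : freeprod X Y) : G := word_eval (repr a).

Lemma fp_lift_class u : fp_lift (fp_class u) = word_eval u.
Proof. exact/fp_eq_word_eval/fp_classP/fp_reprK. Qed.

Lemma fp_liftM : {morph fp_lift : a b / a * b}.
Proof.
move=> a b; rewrite -(fp_reprK a) -(fp_reprK b).
rewrite -[_ * _]/(fp_mul _ _) fp_mulE !fp_lift_class.
by rewrite /word_eval big_cat.
Qed.

Lemma fp_lift1 : fp_lift 1 = 1.
Proof. by rewrite -[1]/(fp_class [::]) fp_lift_class /word_eval big_nil. Qed.

HB.instance Definition _ := isMultiplicative.Build _ _ fp_lift fp_liftM.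
HB.instance Definition _ :=
  Multiplicative_isUMagmaMorphism.Build _ _ fp_lift fp_lift1.

Lemma fp_lift_inl x : fp_lift (fp_inl Y x) = i x.
Proof. by rewrite fp_lift_class /word_eval big_seq1. Qed.
Lemma fp_lift_inr y : fp_lift (fp_inr X y) = j y.
Proof. by rewrite fp_lift_class /word_eval big_seq1. Qed.

(** The first hypothesis says that i and j factor through G(X, Y; phi). *)
Lemma wc_abelian_commute (phi : X -> Y) :
  (forall x, commute (i x) (j (phi x))) -> abelian_group (wc_group phi) ->
  forall x y, commute (i x) (j y).
Proof.
move=> cphi ab x y; apply/commgP/eqP.
rewrite -fp_lift_inl -fp_lift_inr -gmulfR.
(* the commutator of x and y is a consequence of the relators, which fp_lift
   sends to 1 *)
have : [~ fp_inl Y x, fp_inr X y] \in nclosure (wc_relators phi).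
  rewrite -[[~ _, _]]mulg1 -invg1; apply/quot_projP; rewrite gmulfR gmulf1.
  exact/eqP/commgP/ab.
apply: (nclosure_ind (P := fun c => fp_lift c = 1)) =>
  [|a b|a|_ [x' _ <-]|a g] /=.
- exact: gmulf1.
- by rewrite fp_liftM => -> ->; rewrite mulg1.
- by rewrite gmulfV /= => ->; rewrite invg1.
- by rewrite gmulfR /= fp_lift_inl fp_lift_inr; apply/eqP/commgP.
- by rewrite gmulfJ /= => ->; rewrite conj1g.
Qed.
End Universal.

Lemma wc_generated (X Y : groupType) (phi : X -> Y) (g : wc_group phi) :
  g \in gen (range (wc_inl phi) `|` range (wc_inr phi)).
Proof.
rewrite -(quot_reprK g) -(fp_reprK (repr g)).
elim: (repr (repr g)) => [|a u IHu].
  by rewrite -[fp_class _]/(1 : freeprod X Y) gmulf1 gpred1.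
have -> : fp_class (a :: u) = (fp_class [:: a] : freeprod X Y) * fp_class u.
  by rewrite -[RHS]/(fp_mul _ _) fp_mulE.
rewrite gmulfM gpredM // mem_gen //.
by case: a => z; [left; exists z | right; exists z].
Qed.

Lemma wc_commute (X Y : groupType) (phi : X -> Y) x :
  commute (wc_inl phi x) (wc_inr phi (phi x)).
Proof.
apply/commgP/eqP; rewrite /wc_inl /wc_inr.
rewrite -[LHS](gmulfR (quot_proj (nclosure (wc_relators phi)))).
rewrite -[RHS](@gmulf1 _ _ (quot_proj (nclosure (wc_relators phi)))).
apply/quot_projP; rewrite divg1; apply/asboolP => K; apply.
by exists x.
Qed.

(** * Linked pairs of subgroups *)

(** Morphisms i, j from X, Y with images generating G, central subsets M of X
    and N of Y with commuting images, and a correspondence L between X and Y,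
    total on both sides, whose related elements have commuting images and which
    matches the M-cosets with the N-cosets.  A relation is used in place of a
    map so that the notion is symmetric ([linked_sym]). *)
Record linked (X Y G : groupType) (i : UMagmaMorphism.type X G)
    (j : UMagmaMorphism.type Y G) (M : {pred X}) (N : {pred Y})
    (L : X -> Y -> Prop) : Prop := Linked {
  lk_gen : forall g, g \in gen (range i `|` range j);
  lk_cenM : central [set` M];
  lk_cenN : central [set` N];
  lk_MN : {in M & N, forall m n, commute (i m) (j n)};
  lk_comm : forall x y, L x y -> commute (i x) (j y);
  lk_exr : forall x, exists y, L x y;
  lk_exl : forall y, exists x, L x y;
  lk_cosetM : forall x y, L x y ->
    {in M, forall m, exists2 n, n \in N & L (m * x) (n * y)};
  lk_cosetN : forall x y, L x y ->
    {in N, forall n, exists2 m, m \in M & L (m * x) (n * y)}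
}.

Lemma linked_sym (X Y G : groupType) (i : UMagmaMorphism.type X G)
    (j : UMagmaMorphism.type Y G) (M : {pred X}) (N : {pred Y}) L :
  linked i j M N L -> linked j i N M (fun y x => L x y).
Proof.
case=> gn cM cN cMN cL exr exl coM coN; split=> //.
- by move=> g; rewrite setUC.
- by move=> n m nN mM; apply/commute_sym/cMN.
- by move=> y x /cL/commute_sym.
- by move=> y x Lxy n nN; apply: coN Lxy _ nN.
- by move=> y x Lxy m mM; apply: coM Lxy _ mM.
Qed.

(** The subgroup generated by i(M) and by the conjugates of j(N) under i(X). *)
Definition hull (X Y G : groupType) (i : X -> G) (j : Y -> G)
    (M : {pred X}) (N : {pred Y}) : {pred G} :=
  gen (i @` [set` M] `|` [set j n ^ i x | n in [set` N] & x in [set: X]]).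

Lemma hull_l (X Y G : groupType) (i : X -> G) (j : Y -> G)
    (M : {pred X}) (N : {pred Y}) m : m \in M -> i m \in hull i j M N.
Proof. by move=> mM; apply: mem_gen; left; exists m. Qed.

Lemma hull_rJ (X Y G : groupType) (i : X -> G) (j : Y -> G)
    (M : {pred X}) (N : {pred Y}) n x :
  n \in N -> j n ^ i x \in hull i j M N.
Proof. by move=> nN; apply: mem_gen; right; exists n => //; exists x. Qed.

Lemma hull_r (X Y G : groupType) (i : UMagmaMorphism.type X G) (j : Y -> G)
    (M : {pred X}) (N : {pred Y}) n : n \in N -> j n \in hull i j M N.
Proof.
by move=> nN; rewrite -(conjg1 (j n)) -(@gmulf1 _ _ i); apply: hull_rJ.
Qed.

(** * The hull is abelian and normal *)

Lemma commute_twist (G : groupType) (m n x y : G) :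
  commute m x -> commute n y -> commute m n -> commute x y ->
  commute (m * x) (n * y) -> m ^ y * n = m * n ^ x.
Proof.
rewrite /commute => cmx cny cmn cxy cmxny.
(* both sides become n y m x after left multiplication by x y *)
apply: (mulgI (x * y)); transitivity (n * y * (m * x)).
  by rewrite -cmxny conjgE -!mulgA mulVKg -cny !mulgA cmx.
rewrite conjgE cxy -[RHS]mulgA (mulgA x) -cmx -!mulgA mulVKg.
by rewrite (mulgA m) cmn !mulgA -cny -!mulgA.
Qed.

Section LinkedHull.
Variables (X Y G : groupType) (i : UMagmaMorphism.type X G).
Variables (j : UMagmaMorphism.type Y G) (M : {pred X}) (N : {pred Y}).
Variable L : X -> Y -> Prop.
Hypothesis lkL : linked i j M N L.

Let comMX m x : m \in M -> commute (i m) (i x).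
Proof. by move=> mM; apply/gmulf_commute/(lk_cenM lkL). Qed.
Let comNY n y : n \in N -> commute (j n) (j y).
Proof. by move=> nN; apply/gmulf_commute/(lk_cenN lkL). Qed.

Lemma linked_twistM x y m : L x y -> m \in M ->
  exists2 n, n \in N & i m ^ j y * j n = i m * j n ^ i x.
Proof.
move=> Lxy mM; have [n nN Lmn] := lk_cosetM lkL Lxy mM; exists n => //.
apply: commute_twist; [exact: comMX | exact: comNY | exact: (lk_MN lkL)
  | exact: (lk_comm lkL) |].
by rewrite -!gmulfM; apply: (lk_comm lkL).
Qed.

Lemma linked_twistN x y n : L x y -> n \in N ->
  exists2 m, m \in M & i m ^ j y * j n = i m * j n ^ i x.
Proof.
move=> Lxy nN; have [m mM Lmn] := lk_cosetN lkL Lxy nN; exists m => //.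
apply: commute_twist; [exact: comMX | exact: comNY | exact: (lk_MN lkL)
  | exact: (lk_comm lkL) |].
by rewrite -!gmulfM; apply: (lk_comm lkL).
Qed.

(** By the twist, n^x = m^-1 m^y n, and n' commutes with each factor; for m^y
    this holds because y fixes n'. *)
Lemma linked_commute_conj n n' x :
  n \in N -> n' \in N -> commute (j n ^ i x) (j n').
Proof.
move=> nN n'N; have [y Lxy] := lk_exr lkL x.
have [m mM e] := linked_twistN Lxy nN.
have -> : j n ^ i x = (i m)^-1 * (i m ^ j y * j n) by rewrite e mulKg.
have cm m' : m' \in M -> commute (j n') (i m').
  by move=> m'M; apply/commute_sym/(lk_MN lkL).
apply/commute_sym/commuteM; first exact/commuteV/cm.
apply: commuteM; last exact: comNY.
by rewrite -(conjg_commute (comNY y n'N)); apply/commuteJ/cm.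
Qed.

Lemma hull_commutative : commutative_on (hull i j M N).
Proof.
have cMN m n x : m \in M -> n \in N -> commute (i m) (j n ^ i x).
  move=> mM nN; rewrite -(conjg_commute (comMX x mM)); apply: commuteJ.
  exact: (lk_MN lkL).
apply: gen_commutative => a b.
move=> [[m mM <-]|[n nN [x _ <-]]] [[m' m'M <-]|[n' n'N [x' _ <-]]].
- exact: comMX.
- exact: cMN.
- exact/commute_sym/cMN.
rewrite -(conjgKV (i x') (j n ^ i x)); apply: commuteJ.
by rewrite -conjgM -gmulfV -gmulfM; apply: linked_commute_conj.
Qed.

Lemma hull_lJ m y : m \in M -> i m ^ j y \in hull i j M N.
Proof.
move=> mM; have [x Lxy] := lk_exl lkL y.
have [n nN e] := linked_twistM Lxy mM.
rewrite -(mulgK (j n) (_ ^ _)) e.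
apply: gpredF; last exact: hull_r.
by apply: gpredM; [apply: hull_l | apply: hull_rJ].
Qed.

Lemma hull_Jl g x : g \in hull i j M N -> g ^ i x \in hull i j M N.
Proof.
apply: (gen_ind (P := fun g => g ^ i x \in hull i j M N)) => {g}.
- by rewrite conj1g gpred1.
- by move=> a b aB bB; rewrite conjMg gpredM.
- by move=> a aB; rewrite conjVg gpredV.
move=> _ [[m mM <-]|[n nN [x' _ <-]]].
  by rewrite (conjg_commute (comMX x mM)); apply: hull_l.
by rewrite -conjgM -gmulfM; apply: hull_rJ.
Qed.
End LinkedHull.

(** The hull is unchanged when the two sides are exchanged. *)
Lemma hullC (X Y G : groupType) (i : UMagmaMorphism.type X G)
    (j : UMagmaMorphism.type Y G) (M : {pred X}) (N : {pred Y}) L :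
  linked i j M N L -> hull i j M N =i hull j i N M.
Proof.
move=> lkL; have lkL' := linked_sym lkL.
move=> g; apply/idP/idP; apply: (gen_ind (P := fun g => g \in _)) => {g}.
- exact: gpred1.
- by move=> a b aB bB; rewrite gpredM.
- by move=> a aB; rewrite gpredV.
- by move=> _ [[m mM <-]|[n nN [x' _ <-]]];
    [apply: hull_r | apply: (hull_lJ lkL')].
- exact: gpred1.
- by move=> a b aB bB; rewrite gpredM.
- by move=> a aB; rewrite gpredV.
- by move=> _ [[m mM <-]|[n nN [x' _ <-]]];
    [apply: hull_r | apply: (hull_lJ lkL)].
Qed.

Section LinkedNormal.
Variables (X Y G : groupType) (i : UMagmaMorphism.type X G).
Variables (j : UMagmaMorphism.type Y G) (M : {pred X}) (N : {pred Y}).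
Variable L : X -> Y -> Prop.
Hypothesis lkL : linked i j M N L.
Let B := hull i j M N.

Lemma hull_J b g : b \in B -> b ^ g \in B.
Proof.
have := lk_gen lkL g.
pose P g := forall b, b \in B -> b ^ g \in B /\ b ^ g^-1 \in B.
move=> gG bB; suff /(_ b bB)[] : P g by [].
move: g gG b bB => g gG _ _; move: g gG; apply: gen_ind.
- by move=> b bB; rewrite invg1 conjg1.
- move=> a b Pa Pb c cB; rewrite invgM !conjgM; split.
    by case/Pa: cB => + _ => /Pb[].
  by case/Pb: cB => _ => /Pa[].
- by move=> a Pa b /Pa[]; rewrite invgK.
move=> _ [[x _ <-]|[y _ <-]] b bB; rewrite -gmulfV.
  by split; apply: (hull_Jl lkL).
rewrite !/B !(hullC lkL) in bB *.
by split; apply: (hull_Jl (linked_sym lkL)).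
Qed.

Lemma nclosure_hull g :
  g \in nclosure [set` gen (i @` [set` M] `|` j @` [set` N])] -> g \in B.
Proof.
apply: (nclosure_ind (P := fun g => g \in B)) => [|a b aB bB|a|a|a b].
- exact: gpred1.
- by rewrite gpredM.
- by rewrite gpredV.
- apply: (gen_ind (P := fun g => g \in B)) => [|b c bB cB|b|].
  + exact: gpred1.
  + by rewrite gpredM.
  + by rewrite gpredV.
  by move=> _ [[m mM <-]|[n nN <-]]; [apply: hull_l | apply: hull_r].
- exact: hull_J.
Qed.
End LinkedNormal.

(** * Squares of commutators *)

Section LinkedSquares.
Variables (X Y G : groupType) (i : UMagmaMorphism.type X G).
Variables (j : UMagmaMorphism.type Y G) (M : {pred X}) (N : {pred Y}).
Variable L : X -> Y -> Prop.
Hypothesis lkL : linked i j M N L.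
Let B := hull i j M N.

Lemma linked_commgE n x y : n \in N -> L x y ->
  exists2 m, m \in M & [~ j n, i x] = [~ i m, j y].
Proof.
move=> nN Lxy; have [m mM e] := linked_twistN lkL Lxy nN; exists m => //.
rewrite [RHS]commgEl -(mulgK (j n) (i m ^ _)) e -[i m * _ / _]mulgA mulKg.
have nB : (j n)^-1 \in B by rewrite gpredV; apply: hull_r.
exact: (hull_commutative lkL nB (hull_rJ i j M x nN)).
Qed.

(** Write the commutator as [m, y] with y related to x: both m and y commute
    with x. *)
Lemma linked_commg_fix n x : n \in N -> [~ j n, i x] ^ i x = [~ j n, i x].
Proof.
move=> nN; have [y Lxy] := lk_exr lkL x.
have [m mM ->] := linked_commgE nN Lxy.
have cmx : commute (i m) (i x) by apply/gmulf_commute/(lk_cenM lkL).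
rewrite commgEl conjMg conjVg (conjg_commute cmx) -conjgM -(lk_comm lkL Lxy).
by rewrite conjgM (conjg_commute cmx).
Qed.

Hypothesis XM : forall x x', [~ x, x'] \in M.

(** Since [x, x'] lies in M, which is part of the abelian hull, the action of X
    on the hull is commutative. *)
Lemma hull_conjC b x x' : b \in B -> b ^ i (x * x') = b ^ i (x' * x).
Proof.
move=> bB; rewrite commgC gmulfM conjgM; apply: conjg_commute.
by apply: (hull_commutative lkL); [apply: (hull_J lkL) | apply: hull_l].
Qed.

Lemma linked_commg_sqr_comm n x x' : n \in N ->
  commute ([~ j n, i x] ^+ 2) (i x').
Proof.
move=> nN; set c := [~ j n, i x]; set d := [~ j n, i x'].
set e := [~ c, i x'].
have nB : j n \in B by apply: hull_r.
have commgB b g : b \in B -> [~ b, g] \in B.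
  by move=> bB; rewrite commgEl gpredM ?gpredV //; apply: (hull_J lkL).
have cB : c \in B by apply: commgB.
have dB : d \in B by apply: commgB.
have eB : e \in B by apply: commgB.
have cE := hull_commutative lkL.
have cx : c ^ i x = c by apply: linked_commg_fix.
have dx' : d ^ i x' = d by apply: linked_commg_fix.
have nx : j n ^ i x = j n * c by rewrite mulVKg.
have nx' : j n ^ i x' = j n * d by rewrite mulVKg.
have cx' : c ^ i x' = c * e by rewrite mulVKg.
(* with visible bodies, c, d, e would themselves be matched as products *)
clearbody e; clearbody c d.
(* x x' and x' x act alike on n, c and d *)
have dx : d ^ i x = d * e.
  have := hull_conjC x x' nB; rewrite !gmulfM !conjgM nx nx' !conjMg nx nx'.
  rewrite cx' -!mulgA => /mulgI; rewrite mulgA (cE d c) // -mulgA.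
  by move=> /mulgI ->.
have ex : e ^ i x = e.
  have := hull_conjC x x' cB; rewrite !gmulfM !conjgM cx cx' conjMg cx.
  by move=> /mulgI <-.
have ex' : e ^ i x' = e.
  have := hull_conjC x x' dB; rewrite !gmulfM !conjgM dx' dx conjMg dx'.
  by move=> /mulgI ->.
(* additively, [n, x x'] = c + d + e, which x x' fixes and maps to c + d + 3 e *)
have e2 : e * e = 1.
  have nxx' : [~ j n, i (x * x')] = d * (c * e).
    by rewrite commgEl gmulfM conjgM nx conjMg nx' cx' -mulgA mulKg.
  have := linked_commg_fix (x * x') nN; rewrite nxx' gmulfM conjgM.
  rewrite (conjMg d) (conjMg c) dx cx ex.
  rewrite (conjMg (d * e)) (conjMg d) (conjMg c) dx' cx' ex' -!mulgA => /mulgI.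
  by rewrite (cE c e) // => /mulgI; rewrite -[RHS]mulg1 => /mulgI.
apply/commgP; rewrite -conjg_fix conjXg cx' expgMn; last exact: cE.
by rewrite (expg2 e) e2 mulg1.
Qed.
End LinkedSquares.

Section LinkedSquaresCentral.
Variables (X Y G : groupType) (i : UMagmaMorphism.type X G).
Variables (j : UMagmaMorphism.type Y G) (M : {pred X}) (N : {pred Y}).
Variable L : X -> Y -> Prop.
Hypothesis lkL : linked i j M N L.
Hypothesis XM : forall x x', [~ x, x'] \in M.
Hypothesis YN : forall y y', [~ y, y'] \in N.
Let B := hull i j M N.

(** As [n, x] is also of the form [m, y], the one-sided result applies on both
    sides. *)
Lemma linked_commg_sqr_central n x g :
  n \in N -> commute ([~ j n, i x] ^+ 2) g.
Proof.
move=> nN; move: g (lk_gen lkL g); apply: gen_ind.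
- exact: commute1.
- by move=> a b; apply: commuteM.
- by move=> a; apply: commuteV.
move=> _ [[x' _ <-]|[y' _ <-]]; first exact: (linked_commg_sqr_comm lkL).
have [y Lxy] := lk_exr lkL x.
have [m mM ->] := linked_commgE lkL nN Lxy.
exact: (linked_commg_sqr_comm (linked_sym lkL)).
Qed.

Lemma hull_commg_sqr_central v x g :
  v \in B -> commute ([~ v, i x] ^+ 2) g.
Proof.
have cB := hull_commutative lkL.
have commgB b h : b \in B -> [~ b, h] \in B.
  by move=> bB; rewrite commgEl gpredM ?gpredV //; apply: (hull_J lkL).
move=> vB; suff [_] : v \in B /\ forall g, commute ([~ v, i x] ^+ 2) g by [].
move: v vB; apply: gen_ind => [|a b [aB Ca] [bB Cb]|a [aB Ca]|].
- by rewrite gpred1 comm1g expg1n; split=> // h; apply/commute_sym/commute1.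
- rewrite gpredM //; split=> // h.
  have -> : [~ a * b, i x] = [~ a, i x] * [~ b, i x].
    rewrite [LHS]commgEl conjMg invgM -mulgA (mulgA a^-1) -commgEl mulgA.
    by rewrite (cB b^-1) ?gpredV ?commgB // -mulgA.
  rewrite expgMn; last by apply: cB; apply: commgB.
  by apply/commute_sym/commuteM; apply/commute_sym.
- rewrite gpredV; split=> // h.
  have -> : [~ a^-1, i x] = [~ a, i x]^-1.
    rewrite [LHS]commgEl conjVg invgK [in RHS]commgEl [RHS]invgM invgK.
    exact/commuteV/cB/(hull_J lkL).
  by rewrite expVgn; apply/commute_sym/commuteV/commute_sym.
move=> _ [[m mM <-]|[n nN [x' _ <-]]].
  split=> [|h]; first exact: hull_l.
  have /commgP/eqP-> : commute (i m) (i x) by apply/gmulf_commute/(lk_cenM lkL).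
  by rewrite expg1n; apply/commute_sym/commute1.
split=> [|h]; first exact: hull_rJ.
rewrite -{1}(conjgKV (i x') (i x)) -conjRg -conjXg -gmulfV -gmulfJ.
by rewrite conjg_commute; apply: linked_commg_sqr_central.
Qed.
End LinkedSquaresCentral.

(** The squares of [V, G] are central for every subset V of the hull. *)
Lemma linked_squares_central (X Y G : groupType) (i : UMagmaMorphism.type X G)
    (j : UMagmaMorphism.type Y G) (M : {pred X}) (N : {pred Y}) L :
  linked i j M N L ->
  (forall x x', [~ x, x'] \in M) -> (forall y y', [~ y, y'] \in N) ->
  forall V : {pred G}, {subset V <= hull i j M N} ->
  central (squares (commutator_subgroup V)).
Proof.
move=> lkL XM YN V VB _ [u uV <-] g; set B := hull i j M N in VB.
have cB := hull_commutative lkL.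
have commgB b h : b \in B -> [~ b, h] \in B.
  by move=> bB; rewrite commgEl gpredM ?gpredV //; apply: (hull_J lkL).
have CB h : forall v, v \in B -> forall g, commute ([~ v, h] ^+ 2) g.
  move: h (lk_gen lkL h); apply: gen_ind => [|a b Ca Cb|a Ca|].
  - by move=> v _ h; rewrite commg1 expg1n; apply/commute_sym/commute1.
  - move=> v vB h.
    have -> : [~ v, a * b] = [~ v, a] * [~ v ^ a, b].
      by rewrite !commgEl conjgM -mulgA mulVKg.
    have vaB : v ^ a \in B by apply: (hull_J lkL).
    rewrite expgMn; last by apply: cB; apply: commgB.
    by apply/commute_sym/commuteM; apply/commute_sym; [apply: Ca | apply: Cb].
  - move=> v vB h.
    have -> : [~ v, a^-1] = [~ v ^ a^-1, a]^-1.
      by rewrite [in RHS]commgEl conjgKV invgM invgK.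
    rewrite expVgn; apply/commute_sym/commuteV/commute_sym/Ca.
    exact: (hull_J lkL).
  move=> _ [[x _ <-]|[y _ <-]] v vB h.
    exact: (hull_commg_sqr_central lkL).
  rewrite /B (hullC lkL) in vB.
  exact: (hull_commg_sqr_central (linked_sym lkL)).
suff [_] : u \in B /\ forall g, commute (u ^+ 2) g by [].
move: u uV; apply: gen_ind => [|a b [aB Ca] [bB Cb]|a [aB Ca]|].
- by rewrite gpred1 expg1n; split=> // h; apply/commute_sym/commute1.
- rewrite gpredM //; split=> // h; rewrite expgMn; last exact: cB.
  by apply/commute_sym/commuteM; apply/commute_sym.
- rewrite gpredV expVgn; split=> // h.
  exact/commute_sym/commuteV/commute_sym.
by move=> _ [v /VB vB [h _ <-]]; split; [apply: commgB | apply: CB].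
Qed.

(** * The extended bijection links the two groups *)

Lemma quotient_abelianP (G : groupType) (M : normalClosed G) :
  abelian_group (quotient M) -> forall x y, [~ x, y] \in M.
Proof.
move=> ab x y; rewrite -[[~ x, y]]divg1; apply/quot_projP.
by rewrite gmulfR gmulf1; apply/eqP/commgP/ab.
Qed.

Section FstarTheory.
Variables (Ht Kt : groupType) (M : normalClosed Ht) (N : normalClosed Kt).
Variables (tH : based_transversal M) (tK : based_transversal N).
Variables (f : quotient M -> quotient N).
Variables (alpha gamma : subgroup M -> subgroup N).
Hypotheses (f_bij : bijective f) (f1 : f 1 = 1).
Hypotheses (alpha_bij : bijective alpha) (gamma_bij : bijective gamma).
Let phi := fstar tH tK f alpha gamma.

Lemma quot_proj_fstar x : quot_proj N (phi x) = f (quot_proj M x).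
Proof.
rewrite /phi /fstar; case: eqP => [->|_]; last exact: quot_proj_mul.
rewrite f1 -(@gmulf1 _ _ (quot_proj N)); apply/quot_projP.
by rewrite divg1; apply: valP.
Qed.

Lemma fstar_surj y : exists x, phi x = y.
Proof.
case: f_bij => g fK gK; case: alpha_bij => a' _ aK; case: gamma_bij => c' _ cK.
have [y1|y1] := eqVneq (quot_proj N y) 1.
  exists (val (a' (mpart tK y))); rewrite /phi fstarM aK.
  by rewrite -[RHS](mpartK tK) y1 trep1 mulg1.
exists (val (c' (mpart tK y)) * tH (g (quot_proj N y))).
rewrite /phi fstarMh ?cK ?gK ?mpartK // => g1.
by move: y1; rewrite -(gK (quot_proj N y)) g1 f1 eqxx.
Qed.

Lemma fstar_cosetM x m : m \in M -> phi (m * x) / phi x \in N.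
Proof.
move=> mM; apply/quot_projP; rewrite !quot_proj_fstar; congr f.
by apply/quot_projP; rewrite mulgK.
Qed.

Lemma fstar_cosetN x n :
  n \in N -> exists2 m, m \in M & phi (m * x) = n * phi x.
Proof.
move=> nN; have [z zE] := fstar_surj (n * phi x); exists (z / x).
  apply/quot_projP/(bij_inj f_bij); rewrite -!quot_proj_fstar zE.
  by apply/quot_projP; rewrite mulgK.
by rewrite mulgVK.
Qed.

Hypotheses (M_central : central [set` M]) (N_central : central [set` N]).
Hypothesis (GMN_abelian : abelian_group (wc_group alpha)).

Lemma fstar_linked :
  linked (wc_inl phi) (wc_inr phi) M N (fun x y => phi x = y).
Proof.
split=> //.
- exact: wc_generated.
- move=> m n mM nN.
  (* i and j factor through G(M, N; alpha), because phi extends alpha *)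
  pose i : UMagmaMorphism.type (subgroup M) (wc_group phi) := wc_inl phi \o val.
  pose j : UMagmaMorphism.type (subgroup N) (wc_group phi) := wc_inr phi \o val.
  apply: (@wc_abelian_commute _ _ _ i j alpha _ GMN_abelian
    (Sub m mM) (Sub n nN)).
  by move=> x /=; rewrite -(fstarM tH tK f alpha gamma); apply: wc_commute.
- by move=> x _ <-; apply: wc_commute.
- by move=> x; exists (phi x).
- exact: fstar_surj.
- move=> x _ <- m mM; exists (phi (m * x) / phi x); first exact: fstar_cosetM.
  by rewrite mulgVK.
- by move=> x _ <- n nN; apply: fstar_cosetN.
Qed.
End FstarTheory.

Theorem theorem2
  (Ht Kt : groupType) (M : normalClosed Ht) (N : normalClosed Kt)
  (tH : based_transversal M) (tK : based_transversal N)
  (f : quotient M -> quotient N) (alpha gamma : subgroup M -> subgroup N)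
  (f_bij : bijective f) (f1 : f 1 = 1)
  (alpha_bij : bijective alpha) (alpha1 : alpha 1 = 1)
  (gamma_bij : bijective gamma)
  (M_central : central [set` M]) (N_central : central [set` N])
  (GMN_abelian : abelian_group (wc_group alpha)) :
  let phi := fstar tH tK f alpha gamma in
  let V : {pred wc_group phi} :=
    nclosure [set` gen (wc_inl phi @` [set` M] `|` wc_inr phi @` [set` N])] in
  commutative_on V /\
  (abelian_group (quotient M) -> abelian_group (quotient N) ->
   central (squares (commutator_subgroup V))).
Proof.
move=> phi V.
have lkL : linked (wc_inl phi) (wc_inr phi) M N (fun x y => phi x = y).
  exact: fstar_linked.
have VB g : g \in V -> g \in hull (wc_inl phi) (wc_inr phi) M N.
  exact: (nclosure_hull lkL).
split=> [x y /VB xB /VB yB|Hab Kab]; first exact: (hull_commutative lkL).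
exact: (linked_squares_central lkL (quotient_abelianP Hab)
  (quotient_abelianP Kab) VB).
Qed.
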